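(* Let $V$ be a finite-dimensional simple $L$-module. Then either $V\simeq \Bbbk_a$ for a unique $a\in \Bbbk^{\times}$, or else $V\simeq \mathcal{U}_{a,b}$ for some $a,b \in \Bbbk^{\times}$. Moreover, for $a,b,c\in\Bbbk^\times$, $\mathcal{U}_{a,b}\simeq \mathcal{U}_{a,c}$ if and only if $b=c$.
   Context: $\Bbbk$ is an algebraically closed field of characteristic $0$. $L$ is the $\Bbbk$-algebra generated by $y$ and $g^{\pm 1}$ with relations $gg^{-1}=g^{-1}g=1$ and $gyg^{-1}=-y$. Modules are left modules. For $a\in\Bbbk^{\times}$, $\Bbbk_a$ is the one-dimensional $L$-module $\Bbbk$ with $y\cdot 1=0$, $g\cdot 1=a$. For $a,b\in\Bbbk^{\times}$, $\mathcal{U}_{a,b}=\Bbbk^2$ is the $L$-module given by $g\mapsto \begin{pmatrix} a&0\\0&-a\end{pmatrix}$, $y\mapsto \begin{pmatrix}0&b\\1&0\end{pmatrix}$. *)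

(* Defs.v *)
From HB Require Import structures.
From mathcomp Require Import all_boot all_order all_algebra.
From mathcomp Require Import boolp.

Set Implicit Arguments.
Unset Strict Implicit.
Unset Printing Implicit Defensive.

Import GRing.Theory.
Local Open Scope ring_scope.
Local Open Scope quotient_scope.

(* The algebra with generators y, g, g^-1 is the quotient of formal expressions
   by the least congruence that contains the axioms of unital associative
   k-algebras and the relations. [LggV], [LgVg], [LgygV], [liftL_correct] and
   [liftL_unique] establish its universal property. *)
Inductive expr (k : Type) : Type :=
| EC of k
| Ey
| Eg
| EgV
| EAdd of expr k & expr k
| EMul of expr k & expr k.

Arguments Ey {k}.
Arguments Eg {k}.
Arguments EgV {k}.

Inductive eqL (k : fieldType) : expr k -> expr k -> Prop :=
| eqL_refl s : eqL s s
| eqL_sym s t : eqL s t -> eqL t s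
| eqL_trans t s u : eqL s t -> eqL t u -> eqL s u
| eqL_add s s' t t' : eqL s s' -> eqL t t' -> eqL (EAdd s t) (EAdd s' t')
| eqL_mul s s' t t' : eqL s s' -> eqL t t' -> eqL (EMul s t) (EMul s' t')
| eqL_addA s t u : eqL (EAdd s (EAdd t u)) (EAdd (EAdd s t) u)
| eqL_addC s t : eqL (EAdd s t) (EAdd t s)
| eqL_add0 s : eqL (EAdd (EC 0) s) s
| eqL_addN s : eqL (EAdd (EMul (EC (-1)) s) s) (EC 0)
| eqL_mulA s t u : eqL (EMul s (EMul t u)) (EMul (EMul s t) u)
| eqL_mul1l s : eqL (EMul (EC 1) s) s
| eqL_mulDl s t u : eqL (EMul (EAdd s t) u) (EAdd (EMul s u) (EMul t u))
| eqL_mulDr s t u : eqL (EMul s (EAdd t u)) (EAdd (EMul s t) (EMul s u))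
| eqL_CD a b : eqL (EC (a + b)) (EAdd (EC a) (EC b))
| eqL_CM a b : eqL (EC (a * b)) (EMul (EC a) (EC b))
| eqL_Ccomm a s : eqL (EMul (EC a) s) (EMul s (EC a))
| eqL_ggV : eqL (EMul Eg EgV) (EC 1)
| eqL_gVg : eqL (EMul EgV Eg) (EC 1)
| eqL_gygV : eqL (EMul (EMul Eg Ey) EgV) (EMul (EC (-1)) Ey).

HB.instance Definition _ (k : Type) := gen_eqMixin (expr k).
HB.instance Definition _ (k : Type) := gen_choiceMixin (expr k).

Section AlgebraL.
Variable k : fieldType.
Implicit Types s t u : expr k.

Definition eqLb s t : bool := `[< eqL s t >].

Lemma eqLb_refl : reflexive eqLb.
Proof. by move=> s; apply/asboolP; exact: eqL_refl. Qed.

Lemma eqLb_sym : symmetric eqLb.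
Proof. by move=> s t; apply/asboolP/asboolP; exact: eqL_sym. Qed.

Lemma eqLb_trans : transitive eqLb.
Proof.
by move=> t s u /asboolP st /asboolP tu; apply/asboolP; exact: eqL_trans st tu.
Qed.

Canonical eqL_equiv := EquivRel eqLb eqLb_refl eqLb_sym eqLb_trans.

Definition L : Type := {eq_quot eqL_equiv}.
HB.instance Definition _ := Choice.on L.

Definition mkL (s : expr k) : L := \pi_{eq_quot eqL_equiv} s.
Definition reprL (x : L) : expr k := repr (x : {eq_quot eqL_equiv}).

Lemma reprLK x : mkL (reprL x) = x.
Proof. exact: reprK. Qed.

Lemma mkLP s t : mkL s = mkL t <-> eqL s t.
Proof.
split=> [/eqquotP/asboolP //|st].
by apply/eqquotP/asboolP.
Qed.

Lemma reprL_mk s : eqL (reprL (mkL s)) s.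
Proof. by apply/mkLP; rewrite reprLK. Qed.

Lemma mkL_ind (P : L -> Prop) : (forall s, P (mkL s)) -> forall x, P x.
Proof. by move=> Ps x; rewrite -(reprLK x). Qed.

Definition addL x y := mkL (EAdd (reprL x) (reprL y)).
Definition mulL x y := mkL (EMul (reprL x) (reprL y)).
Definition oppL x := mkL (EMul (EC (-1)) (reprL x)).
Definition scaleL (a : k) x := mkL (EMul (EC a) (reprL x)).

Lemma addLE s t : addL (mkL s) (mkL t) = mkL (EAdd s t).
Proof. by apply/mkLP/eqL_add; exact: reprL_mk. Qed.

Lemma mulLE s t : mulL (mkL s) (mkL t) = mkL (EMul s t).
Proof. by apply/mkLP/eqL_mul; exact: reprL_mk. Qed.

Lemma scaleLE a s : scaleL a (mkL s) = mkL (EMul (EC a) s).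
Proof. by apply/mkLP/eqL_mul; [exact: eqL_refl | exact: reprL_mk]. Qed.

Lemma oppLE s : oppL (mkL s) = mkL (EMul (EC (-1)) s).
Proof. exact: scaleLE. Qed.

Lemma addLA : associative addL.
Proof.
elim/mkL_ind=> s; elim/mkL_ind=> t; elim/mkL_ind=> u.
by rewrite !addLE; apply/mkLP/eqL_addA.
Qed.

Lemma addLC : commutative addL.
Proof.
by elim/mkL_ind=> s; elim/mkL_ind=> t; rewrite !addLE; apply/mkLP/eqL_addC.
Qed.

Lemma add0L : left_id (mkL (EC 0)) addL.
Proof. by elim/mkL_ind=> s; rewrite addLE; apply/mkLP/eqL_add0. Qed.

Lemma addNL : left_inverse (mkL (EC 0)) oppL addL.
Proof. by elim/mkL_ind=> s; rewrite oppLE addLE; apply/mkLP/eqL_addN. Qed.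

HB.instance Definition _ := GRing.isZmodule.Build L addLA addLC add0L addNL.

Lemma mulLA : associative mulL.
Proof.
elim/mkL_ind=> s; elim/mkL_ind=> t; elim/mkL_ind=> u.
by rewrite !mulLE; apply/mkLP/eqL_mulA.
Qed.

Lemma mul1L : left_id (mkL (EC 1)) mulL.
Proof. by elim/mkL_ind=> s; rewrite mulLE; apply/mkLP/eqL_mul1l. Qed.

Lemma mulL1 : right_id (mkL (EC 1)) mulL.
Proof.
elim/mkL_ind=> s; rewrite mulLE; apply/mkLP.
exact: eqL_trans (eqL_sym (eqL_Ccomm 1 s)) (eqL_mul1l s).
Qed.

Lemma mulLDl : left_distributive mulL addL.
Proof.
elim/mkL_ind=> s; elim/mkL_ind=> t; elim/mkL_ind=> u.
by rewrite addLE !mulLE addLE; apply/mkLP/eqL_mulDl.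
Qed.

Lemma mulLDr : right_distributive mulL addL.
Proof.
elim/mkL_ind=> s; elim/mkL_ind=> t; elim/mkL_ind=> u.
by rewrite addLE !mulLE addLE; apply/mkLP/eqL_mulDr.
Qed.

HB.instance Definition _ :=
  GRing.Zmodule_isPzRing.Build L mulLA mul1L mulL1 mulLDl mulLDr.

Lemma mkL0 : mkL (EC 0) = 0. Proof. by []. Qed.
Lemma mkL1 : mkL (EC 1) = 1. Proof. by []. Qed.
Lemma mkLD s t : mkL (EAdd s t) = mkL s + mkL t.
Proof. exact/esym/addLE. Qed.
Lemma mkLM s t : mkL (EMul s t) = mkL s * mkL t.
Proof. exact/esym/mulLE. Qed.

Section Eval.
Variables (A : pzRingType) (c : k -> A) (y g h : A).

Fixpoint evalE s : A :=
  match s with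
  | EC a => c a
  | Ey => y
  | Eg => g
  | EgV => h
  | EAdd s t => evalE s + evalE t
  | EMul s t => evalE s * evalE t
  end.

Hypotheses (cD : {morph c : a b / a + b}) (cM : {morph c : a b / a * b}).
Hypotheses (c1 : c 1 = 1) (cC : forall a x, c a * x = x * c a).
Hypotheses (gh : g * h = 1) (hg : h * g = 1) (gyh : g * y * h = - y).

Lemma evalE_sound s t : eqL s t -> evalE s = evalE t.
Proof.
have c0 : c 0 = 0 by apply: (addrI (c 0)); rewrite -cD !addr0.
have cN1 : c (-1) = -1.
  by apply: (addIr 1); rewrite -{1}c1 -cD !addNr c0.
elim=> {s t} //=; try by move=> *; congruence.
- by move=> *; rewrite addrA.
- by move=> *; rewrite addrC.
- by move=> *; rewrite c0 add0r.
- by move=> *; rewrite cN1 mulN1r addNr c0.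
- by move=> *; rewrite mulrA.
- by move=> *; rewrite c1 mul1r.
- by move=> *; rewrite mulrDl.
- by move=> *; rewrite mulrDr.
- by rewrite cN1 mulN1r.
Qed.

End Eval.

(* Evaluation at y = 0, g = 1 separates 1 from 0. *)
Lemma oneL_neq0 : (1 : L) != 0.
Proof.
apply/eqP => /mkLP /(@evalE_sound k id 0 1 1) /= H.
have /eqP := H (fun _ _ => erefl) (fun _ _ => erefl) erefl (@mulrC k)
  (mulr1 1) (mulr1 1) (etrans (mulr1 _) (etrans (mulr0 _) (esym (@oppr0 k)))).
by rewrite oner_eq0.
Qed.

HB.instance Definition _ := GRing.PzSemiRing_isNonZero.Build L oneL_neq0.

Lemma scaleLME a x : scaleL a x = mkL (EC a) * x.
Proof. by elim/mkL_ind: x => s; rewrite scaleLE mkLM. Qed.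

Lemma mkL_CD a b : mkL (EC (a + b)) = mkL (EC a) + mkL (EC b).
Proof. by rewrite -mkLD; apply/mkLP/eqL_CD. Qed.

Lemma mkL_CM a b : mkL (EC (a * b)) = mkL (EC a) * mkL (EC b).
Proof. by rewrite -mkLM; apply/mkLP/eqL_CM. Qed.

Lemma mkL_Ccomm a (x : L) : mkL (EC a) * x = x * mkL (EC a).
Proof. by elim/mkL_ind: x => s; rewrite -!mkLM; apply/mkLP/eqL_Ccomm. Qed.

Lemma scaleLA a b x : scaleL a (scaleL b x) = scaleL (a * b) x.
Proof. by rewrite !scaleLME mulrA -mkL_CM. Qed.

Lemma scale1L : left_id 1 scaleL.
Proof. by move=> x; rewrite scaleLME mkL1 mul1r. Qed.

Lemma scaleLDr : right_distributive scaleL +%R.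
Proof. by move=> a x y; rewrite !scaleLME mulrDr. Qed.

Lemma scaleLDl x : {morph scaleL^~ x : a b / a + b}.
Proof. by move=> a b; rewrite !scaleLME mkL_CD mulrDl. Qed.

HB.instance Definition _ :=
  GRing.Zmodule_isLmodule.Build k L scaleLA scale1L scaleLDr scaleLDl.

Lemma scaleLAl (a : k) (u v : L) : a *: (u * v) = (a *: u) * v.
Proof. by rewrite /GRing.scale /= !scaleLME mulrA. Qed.

HB.instance Definition _ := GRing.Lmodule_isLalgebra.Build k L scaleLAl.

Lemma scaleLAr (a : k) (u v : L) : a *: (u * v) = u * (a *: v).
Proof. by rewrite /GRing.scale /= !scaleLME mulrA mkL_Ccomm mulrA. Qed.

HB.instance Definition _ := GRing.Lalgebra_isAlgebra.Build k L scaleLAr.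

Definition Ly : L := mkL Ey.
Definition Lg : L := mkL Eg.
Definition LgV : L := mkL EgV.

Lemma mkL_CE (a : k) : mkL (EC a) = a%:A.
Proof. by rewrite /GRing.scale /= scaleLME mulr1. Qed.

Lemma LggV : Lg * LgV = 1.
Proof. by rewrite -mkLM; apply/mkLP/eqL_ggV. Qed.

Lemma LgVg : LgV * Lg = 1.
Proof. by rewrite -mkLM; apply/mkLP/eqL_gVg. Qed.

Lemma LgygV : Lg * Ly * LgV = - Ly.
Proof.
have /mkLP := eqL_gygV k.
by rewrite !mkLM mkL_CE scaleN1r mulN1r.
Qed.

Section Lift.
Variables (A : algType k) (y g h : A).

Definition liftL (x : L) : A := evalE (fun a => a%:A) y g h (reprL x).

Hypotheses (gh : g * h = 1) (hg : h * g = 1) (gyh : g * y * h = - y).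

Lemma liftL_mk s : liftL (mkL s) = evalE (fun a => a%:A) y g h s.
Proof.
apply: evalE_sound (reprL_mk s) => //.
- by move=> a b; rewrite scalerDl.
- by move=> a b; rewrite -scalerAl mul1r scalerA.
- by rewrite scale1r.
- by move=> a x; rewrite -scalerAl -scalerAr mul1r mulr1.
Qed.

Lemma liftLD : {morph liftL : u v / u + v}.
Proof.
by elim/mkL_ind=> s; elim/mkL_ind=> t; rewrite -mkLD !liftL_mk.
Qed.

Lemma liftLM : {morph liftL : u v / u * v}.
Proof.
by elim/mkL_ind=> s; elim/mkL_ind=> t; rewrite -mkLM !liftL_mk.
Qed.

Lemma liftL_C (a : k) : liftL a%:A = a%:A.
Proof. by rewrite -mkL_CE liftL_mk. Qed.

Lemma liftL1 : liftL 1 = 1.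
Proof. by rewrite -[1]scale1r liftL_C scale1r. Qed.

Lemma liftL_scale (a : k) (u : L) : liftL (a *: u) = a *: liftL u.
Proof. by rewrite -[u in LHS]mul1r scalerAl liftLM liftL_C mulr_algl. Qed.

Lemma liftL_correct :
  exists2 f : {lrmorphism L -> A},
    f =1 liftL & [/\ f Ly = y, f Lg = g & f LgV = h].
Proof.
have lin : linear liftL by move=> a u v; rewrite liftLD liftL_scale.
have mor : monoid_morphism liftL by split; [exact: liftL1 | exact: liftLM].
pose m1 := GRing.isLinear.Build _ _ _ _ _ lin.
pose m2 := GRing.isMonoidMorphism.Build _ _ _ mor.
pose f : {lrmorphism L -> A} := HB.pack liftL m1 m2.
by exists f => //; split; rewrite /= liftL_mk.
Qed.

Lemma liftL_unique (f : {lrmorphism L -> A}) :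
  f Ly = y -> f Lg = g -> f LgV = h -> f =1 liftL.
Proof.
move=> fy fg fh; elim/mkL_ind=> s; rewrite liftL_mk.
elim: s => [a||||s IHs t IHt|s IHs t IHt] //=.
- by rewrite mkL_CE rmorph_alg.
- by rewrite mkLD rmorphD /= IHs IHt.
- by rewrite mkLM rmorphM /= IHs IHt.
Qed.

End Lift.

Definition kstar : Type := {a : k | a != 0}.
HB.instance Definition _ := SubType.on kstar.
HB.instance Definition _ := Choice.on kstar.
Definition kstar_val (a : kstar) : k := val a.

End AlgebraL.

Coercion kstar_val : kstar >-> GRing.Field.sort.

Section Modules.
Variable k : fieldType.

Definition kmod (a : kstar k) : Type := k.
HB.instance Definition _ (a : kstar k) := GRing.Zmodule.on (kmod a).

Section OneDim.
Variable a : kstar k.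

Definition actk : L k -> k^o := @liftL k k^o 0 (a : k) (a : k)^-1.

Let gh : (a : k) * (a : k)^-1 = 1 :> k^o.
Proof. exact: (mulfV (valP a)). Qed.
Let hg : (a : k)^-1 * (a : k) = 1 :> k^o.
Proof. exact: (mulVf (valP a)). Qed.
Let gyh : (a : k) * 0 * (a : k)^-1 = - 0 :> k^o.
Proof. by rewrite mulr0 mul0r oppr0. Qed.

Definition kmod_scale (x : L k) (v : kmod a) : kmod a := actk x * (v : k).

Lemma kmod_scaleA x y v :
  kmod_scale x (kmod_scale y v) = kmod_scale (x * y) v.
Proof. by rewrite /kmod_scale /actk liftLM // mulrA. Qed.
Lemma kmod_scale1 : left_id 1 kmod_scale.
Proof. by move=> v; rewrite /kmod_scale /actk liftL1 // mul1r. Qed.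
Lemma kmod_scaleDr : right_distributive kmod_scale +%R.
Proof. by move=> x u v; rewrite /kmod_scale mulrDr. Qed.
Lemma kmod_scaleDl v : {morph kmod_scale^~ v : x y / x + y}.
Proof. by move=> x y; rewrite /kmod_scale /actk liftLD // mulrDl. Qed.

HB.instance Definition _ := GRing.Zmodule_isLmodule.Build (L k) (kmod a)
  kmod_scaleA kmod_scale1 kmod_scaleDr kmod_scaleDl.

Lemma kmod_C (c : k) (v : kmod a) : (c%:A : L k) *: v = c * (v : k) :> k.
Proof.
rewrite /GRing.scale /= /kmod_scale /actk liftL_C //.
by congr (_ * _); exact: mulr1.
Qed.
Lemma kmod_y : Ly k *: ((1 : k) : kmod a) = (0 : k) :> kmod a.
Proof. by rewrite /GRing.scale /= /kmod_scale /actk liftL_mk // mul0r. Qed.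
Lemma kmod_g : Lg k *: ((1 : k) : kmod a) = (a : k) :> kmod a.
Proof. by rewrite /GRing.scale /= /kmod_scale /actk liftL_mk // mulr1. Qed.

End OneDim.

Definition Umod (a b : kstar k) : Type := 'cV[k]_2.
HB.instance Definition _ (a b : kstar k) := GRing.Zmodule.on (Umod a b).

Section TwoDim.
Variables a b : kstar k.

Definition Ug : 'M[k]_2 := @block_mx k 1 1 1 1 (a : k)%:M 0 0 (- (a : k))%:M.
Definition UgV : 'M[k]_2 :=
  @block_mx k 1 1 1 1 (a : k)^-1%:M 0 0 (- (a : k)^-1)%:M.
Definition Uy : 'M[k]_2 := @block_mx k 1 1 1 1 0 (b : k)%:M 1%:M 0.

Let gh : Ug * UgV = 1.
Proof.
have a0 := valP a.
rewrite /Ug /UgV; rewrite -[LHS]/(_ *m _) (@mulmx_block k 1 1 1 1 1 1).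
rewrite !mul0mx !mulmx0 !addr0 !add0r -!scalar_mxM mulrNN mulfV //.
by rewrite -(@scalar_mx_block k 1 1).
Qed.
Let hg : UgV * Ug = 1.
Proof. exact: mulmx1C gh. Qed.
Let gyh : Ug * Uy * UgV = - Uy.
Proof.
have a0 := valP a.
rewrite /Ug /UgV /Uy -[LHS]/(_ *m _ *m _) !(@mulmx_block k 1 1 1 1 1 1).
rewrite !(mul0mx, mulmx0, addr0, add0r) -!scalar_mxM.
rewrite (@opp_block_mx k 1 1 1 1) !oppr0 -!raddfN /= mulr1 mulrN mulrAC.
by rewrite mulfV // mul1r mulNr mulfV.
Qed.

Definition actU : L k -> 'M[k]_2 := liftL Uy Ug UgV.

Definition Umod_scale (x : L k) (v : Umod a b) : Umod a b := actU x *m v.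

Lemma Umod_scaleA x y v :
  Umod_scale x (Umod_scale y v) = Umod_scale (x * y) v.
Proof. by rewrite /Umod_scale /actU liftLM // mulmxA. Qed.
Lemma Umod_scale1 : left_id 1 Umod_scale.
Proof. by move=> v; rewrite /Umod_scale /actU liftL1 // mul1mx. Qed.
Lemma Umod_scaleDr : right_distributive Umod_scale +%R.
Proof. by move=> x u v; rewrite /Umod_scale mulmxDr. Qed.
Lemma Umod_scaleDl v : {morph Umod_scale^~ v : x y / x + y}.
Proof. by move=> x y; rewrite /Umod_scale /actU liftLD // mulmxDl. Qed.

HB.instance Definition _ := GRing.Zmodule_isLmodule.Build (L k) (Umod a b)
  Umod_scaleA Umod_scale1 Umod_scaleDr Umod_scaleDl.

Lemma Umod_C (c : k) (v : Umod a b) :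
  (c%:A : L k) *: v = c *: (v : 'cV[k]_2) :> 'cV[k]_2.
Proof.
rewrite {1}/GRing.scale /= /Umod_scale /actU liftL_C //.
by rewrite -scalemxAl mul1mx.
Qed.
Lemma Umod_y (v : Umod a b) : Ly k *: v = Uy *m v.
Proof. by rewrite /GRing.scale /= /Umod_scale /actU liftL_mk. Qed.
Lemma Umod_g (v : Umod a b) : Lg k *: v = Ug *m v.
Proof. by rewrite /GRing.scale /= /Umod_scale /actU liftL_mk. Qed.

End TwoDim.

(* k acts on an L-module through the structure map c |-> c%:A of L. *)
Definition finite_dim (V : lmodType (L k)) : Prop :=
  exists s : seq V, forall v : V,
    exists c : 'I_(size s) -> k, v = \sum_i ((c i)%:A : L k) *: s`_i.

End Modules.

Definition simple_mod (R : pzRingType) (V : lmodType R) : Prop :=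
  (exists v : V, v != 0) /\
  forall S : {pred V}, submod_closed S ->
    (forall v, v \in S -> v = 0) \/ (forall v, v \in S).

Definition mod_iso (R : pzRingType) (V W : lmodType R) : Prop :=
  exists f : {linear V -> W}, bijective f.

(* Main.v *)
Require Import Defs.
From HB Require Import structures.
From mathcomp Require Import all_boot all_order all_algebra.
From mathcomp Require Import boolp.
Set Implicit Arguments.
Unset Strict Implicit.
Unset Printing Implicit Defensive.

Import GRing.Theory.
Local Open Scope ring_scope.

(** On a finite-dimensional module every element of [L] has an eigenvector,
    because the powers of the element applied to a fixed vector are linearly
    dependent and the resulting polynomial splits. Let [V] be simple. The kernel
    of [y] is a submodule since [y] normalizes [L]. If it is [V], an eigenvector
    of [g] spans [V], and [V] is some [k_a]. If it is zero, [y^2] is central, so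
    by Schur's argument it acts by a scalar [b], which is nonzero; for an
    eigenvector [v] of [g] with eigenvalue [a], the vectors [v] and [y v] span
    [V] and are eigenvectors of [g] for the distinct eigenvalues [a] and [-a],
    so that [V] is [U_{a,b}]. *)

(** * Isomorphisms and simple modules over an arbitrary ring *)

Lemma mod_iso_sym (R : pzRingType) (V W : lmodType R) :
  mod_iso V W -> mod_iso W V.
Proof.
case=> f [g fK gK].
have lin : linear g.
  by move=> a u v; apply: (can_inj fK); rewrite linearP !gK.
pose m := GRing.isLinear.Build _ _ _ _ _ lin.
pose h : {linear W -> V} := HB.pack g m.
by exists h; exists f.
Qed.

Lemma mod_iso_trans (R : pzRingType) (U V W : lmodType R) :
  mod_iso U V -> mod_iso V W -> mod_iso U W.
Proof.
case=> f bf [g bg]; exists (g \o f : {linear U -> W}); exact: bij_comp bg bf.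
Qed.

Lemma iso_neq0 (R : pzRingType) (V W : lmodType R) (f : {linear V -> W}) v :
  bijective f -> v != 0 -> f v != 0.
Proof.
move=> /bij_inj f_inj; apply: contra_neq => fv.
by apply: f_inj; rewrite fv linear0.
Qed.

(** The image of [f] is a submodule of [V] containing a nonzero vector, so simplicity makes [f]
    onto, and the trivial kernel makes it injective. *)
Lemma simple_mod_iso (R : pzRingType) (V W : lmodType R) (f : {linear W -> V}) :
  simple_mod V -> (exists w, f w != 0) -> (forall w, f w = 0 -> w = 0) ->
  mod_iso V W.
Proof.
move=> [_ simV] [w fw0] kerf; apply: mod_iso_sym; exists f.
pose S : {pred V} := [pred v | `[< exists u, f u = v >]].
have subS : submod_closed S.
  split=> [|a u v]; first by apply/asboolP; exists 0; rewrite linear0.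
  move=> /asboolP[u' <-] /asboolP[v' <-]; apply/asboolP.
  by exists (a *: u' + v'); rewrite linearP.
case: (simV S subS) => [S0|ST].
  by case/eqP: fw0; apply: S0; apply/asboolP; exists w.
have surj v : exists u, f u == v.
  by have /asboolP[u <-] := ST v; exists u.
exists (fun v => xchoose (surj v)); last first.
  by move=> v; exact: (eqP (xchooseP (surj v))).
move=> u; apply/eqP; rewrite -subr_eq0; apply/eqP/kerf.
by rewrite linearB /= (eqP (xchooseP (surj (f u)))) subrr.
Qed.

(** Schur's argument: since [z] can be moved to the right past any scalar, the vectors killed by [z]
    form a submodule, and [v] makes it nonzero. *)
Lemma simple_mod_ann (R : pzRingType) (V : lmodType R) (z : R) (v : V) :
  simple_mod V -> (forall x, exists x', z * x = x' * z) ->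
  v != 0 -> z *: v = 0 -> forall w : V, z *: w = 0.
Proof.
move=> [_ simV] zN v0 zv0.
pose S : {pred V} := [pred w | z *: w == 0].
have subS : submod_closed S.
  split=> [|a u w]; first by rewrite inE scaler0.
  rewrite !inE => /eqP zu /eqP zw; have [x' zx] := zN a.
  by rewrite scalerDr scalerA zx -scalerA zu zw scaler0 addr0.
case: (simV S subS) => [S0|ST] w; last exact/eqP/(ST w).
by case/eqP: v0; apply: S0; rewrite inE zv0.
Qed.

(** * Commutation rules in [L] and reduction to generators *)

Section GeneratorsOfL.
Variable k : fieldType.
Implicit Types (x z : L k) (V W : lmodType (L k)).

Lemma LCcomm (c : k) x : x * c%:A = c%:A * x.
Proof. by rewrite mulr_algl mulr_algr. Qed.

Lemma LgyN : Lg k * Ly k = - (Ly k * Lg k).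
Proof.
by rewrite -mulNr -LgygV -[RHS]mulrA LgVg mulr1.
Qed.

Lemma LygN : Ly k * Lg k = - (Lg k * Ly k).
Proof. by rewrite LgyN opprK. Qed.

Lemma L_ind (P : L k -> Prop) :
  (forall c : k, P c%:A) -> P (Ly k) -> P (Lg k) -> P (LgV k) ->
  (forall x x', P x -> P x' -> P (x + x')) ->
  (forall x x', P x -> P x' -> P (x * x')) -> forall x, P x.
Proof.
move=> PC Py Pg PgV PD PM; elim/mkL_ind; elim=> [c||||s Ps t Pt|s Ps t Pt] //.
- by rewrite mkL_CE.
- by rewrite mkLD; exact: PD.
- by rewrite mkLM; exact: PM.
Qed.

(** The [x] with [z * x] in [L z] include the scalars and are stable under sums and products, so the
    generators suffice. *)
Lemma L_normal z :
  (exists x, z * Ly k = x * z) -> (exists x, z * Lg k = x * z) ->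
  (exists x, z * LgV k = x * z) -> forall x, exists x', z * x = x' * z.
Proof.
move=> zy zg zgV; elim/L_ind => //
  [c|x1 x2 [u1 e1] [u2 e2]|x1 x2 [u1 e1] [u2 e2]].
- by exists c%:A; rewrite LCcomm.
- by exists (u1 + u2); rewrite mulrDr e1 e2 mulrDl.
- by exists (u1 * u2); rewrite mulrA e1 -mulrA e2 mulrA.
Qed.

Lemma LygV : Ly k * LgV k = - LgV k * Ly k.
Proof.
rewrite mulNr -[LHS]mul1r -{1}(LgVg k) -mulrA (mulrA (Lg k)) LgygV.
by rewrite mulrN.
Qed.

Lemma Ly_normal x : exists x', Ly k * x = x' * Ly k.
Proof.
apply: L_normal; first by exists (Ly k).
  by exists (- Lg k); rewrite mulNr -LygN.
by exists (- LgV k); rewrite LygV.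
Qed.

(** Passing [y * y] across [g] or its inverse changes the sign twice, so [y * y] is central. The
    conclusion has the form that [simple_mod_ann] takes. *)
Lemma Ly2_normal (c : k) x :
  exists x', (Ly k * Ly k - c%:A) * x = x' * (Ly k * Ly k - c%:A).
Proof.
apply: L_normal.
- by exists (Ly k); rewrite mulrBl mulrBr LCcomm mulrA.
- exists (Lg k); rewrite mulrBl mulrBr LCcomm; congr (_ - _).
  by rewrite -mulrA LygN mulrN mulrA LygN mulNr opprK mulrA.
- exists (LgV k); rewrite mulrBl mulrBr LCcomm; congr (_ - _).
  by rewrite -mulrA LygV mulrA mulrN LygV !mulNr opprK mulrA.
Qed.

Lemma L_linear V W (f : V -> W) :
  {morph f : u v / u + v} ->
  (forall (c : k) v, f ((c%:A : L k) *: v) = (c%:A : L k) *: f v) ->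
  (forall v, f (Ly k *: v) = Ly k *: f v) ->
  (forall v, f (Lg k *: v) = Lg k *: f v) -> linear f.
Proof.
move=> fD fC fy fg.
have fZ x : forall v, f (x *: v) = x *: f v.
  elim/L_ind: x => // [v|x x' fx fx' v|x x' fx fx' v].
  (* Compatibility with the inverse of [g] follows from that with [g]: insert [LgV * Lg = 1] in
     front of [f (LgV *: v)] and pull [Lg] inside [f]. *)
  - rewrite -[LHS]scale1r -(LgVg k) -scalerA -fg scalerA.
    by rewrite LggV scale1r.
  - by rewrite !scalerDl fD fx fx'.
  - by rewrite -!scalerA fx fx'.
by move=> x u v; rewrite fD fZ.
Qed.

Lemma scaleLC_eq0 V (c : k) (v : V) :
  v != 0 -> (c%:A : L k) *: v = 0 -> c = 0.
Proof.
move=> v0 cv; apply/eqP/negPn/negP => c0; case/eqP: v0.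
by rewrite -[v]scale1r -[1]scale1r -(mulVf c0) -scalerA -mulr_algl
  -scalerA cv scaler0.
Qed.

Lemma scaleLC_inj V (a c : k) (v : V) :
  v != 0 -> (a%:A : L k) *: v = (c%:A : L k) *: v -> a = c.
Proof.
move=> v0 /eqP; rewrite -subr_eq0 -!scalerBl => /eqP /(scaleLC_eq0 v0)/eqP.
by rewrite subr_eq0 => /eqP.
Qed.

Lemma scaleLCA V (c : k) x (v : V) :
  x *: ((c%:A : L k) *: v) = (c%:A : L k) *: (x *: v).
Proof. by rewrite !scalerA LCcomm. Qed.

Lemma scaleLC_eigen V (a c : k) x (v : V) :
  x *: v = (a%:A : L k) *: v ->
  x *: ((c%:A : L k) *: v) = (a%:A : L k) *: ((c%:A : L k) *: v).
Proof. by move=> xv; rewrite scaleLCA xv scaleLCA. Qed.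

End GeneratorsOfL.

(** * Eigenvectors in finite-dimensional modules *)

Section Eigenvectors.
Variable k : closedFieldType.
Implicit Types (x : L k) (V : lmodType (L k)).

Lemma annihilating_poly V x (v : V) :
  finite_dim V -> exists2 p : {poly k}, p != 0 & horner_alg x p *: v = 0.
Proof.
case=> s span_s; set n := size s.
pose c (i : nat) := sval (cid (span_s (x ^+ i *: v))).
have cP i : x ^+ i *: v = \sum_j ((c i j)%:A : L k) *: s`_j.
  by rewrite /c; case: cid.
pose A : 'M[k]_(n.+1, n) := \matrix_(i, j) c i j.
(* Row [i] of [A] expresses [x ^+ i *: v] in the [n] spanning vectors. With [n.+1] rows and [n]
   columns the rows are dependent, and [u] holds the coefficients of a dependence. *)
have /rowV0Pn[u /sub_kermxP uA u0] : kermx A != 0.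
  rewrite kermx_eq0 /row_free neq_ltn; apply/orP; left.
  by rewrite ltnS rank_leq_col.
exists (rVpoly u).
  apply: contra_neq u0 => /(congr1 (poly_rV (d := n.+1))).
  by rewrite rVpolyK linear0.
have -> : horner_alg x (rVpoly u) = \sum_(i < n.+1) u 0 i *: x ^+ i.
  rewrite {1}/rVpoly poly_def linear_sum; apply: eq_bigr => i _.
  by rewrite linearZ /= rmorphXn /= horner_algX valK mulr_algl.
rewrite scaler_suml.
under eq_bigr => i _.
  rewrite -mulr_algl -scalerA cP scaler_sumr.
  under eq_bigr => j _ do rewrite scalerA.
  over.
rewrite exchange_big big1 //= => j _; rewrite -scaler_suml.
suff -> : \sum_(i < n.+1) ((u 0 i)%:A : L k) * (c i j)%:A = 0 by rewrite scale0r.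
have /rowP/(_ j) := uA; rewrite !mxE => uj.
rewrite -[RHS](scale0r 1) -uj scaler_suml; apply: eq_bigr => i _.
by rewrite mxE mulr_algl scalerA.
Qed.

Lemma eigenvector V x : finite_dim V -> (exists v : V, v != 0) ->
  exists (c : k) (w : V), w != 0 /\ x *: w = (c%:A : L k) *: w.
Proof.
move=> fV [v v0]; have [p p0] := annihilating_poly x v fV.
have [rs ->] := closed_field_poly_normal p.
rewrite linearZ /= -scalerA => pv.
(* The leading coefficient of [p] is a nonzero scalar and can be cancelled. *)
have {pv} : horner_alg x (\prod_(z <- rs) ('X - z%:P)) *: v = 0.
  apply: contraNeq p0 => pv0; rewrite -lead_coef_eq0; apply/eqP.
  exact: scaleLC_eq0 pv0 pv.
(* Induction on the roots, for all [v]: if [x - r] kills [v], then [v] is an eigenvector; otherwise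
   the remaining factors kill the nonzero vector [(x - r) v]. *)
elim: rs v v0 => [|r rs IH] v v0.
  by rewrite big_nil rmorph1 scale1r => /eqP; rewrite (negPf v0).
rewrite big_cons mulrC rmorphM -scalerA /= rmorphB /= horner_algX horner_algC.
have [/eqP|w0] := eqVneq ((x - r%:A) *: v) 0; last exact: IH.
by rewrite scalerBl subr_eq0 => /eqP xv _; exists r, v.
Qed.

Lemma Lg_eigenvector V : finite_dim V -> (exists v : V, v != 0) ->
  exists (a : k) (w : V), [/\ a != 0, w != 0 & Lg k *: w = (a%:A : L k) *: w].
Proof.
move=> fV V0; have [a [w [w0 gw]]] := eigenvector (Lg k) fV V0.
exists a, w; split=> //; apply: contra_neq w0 => a0.
(* As [g] is invertible, eigenvalue zero would force [w = 0]. *)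
by rewrite -[w]scale1r -LgVg -scalerA gw a0 !scale0r scaler0.
Qed.

End Eigenvectors.

(** * The actions on [kmod a] and [Umod a b], and their invariants *)

Section Classification.
Variable k : fieldType.
Implicit Types (V : lmodType (L k)) (a b c : kstar k).

Lemma kmod_basis a (u : kmod a) :
  u = ((u : k)%:A : L k) *: ((1 : k) : kmod a).
Proof. by rewrite kmod_C mulr1. Qed.

Lemma kmod_yE a (u : kmod a) : Ly k *: u = 0.
Proof.
by rewrite (kmod_basis u) scalerA LCcomm -scalerA kmod_y scaler0.
Qed.

Lemma kmod_gE a (u : kmod a) : Lg k *: u = ((a : k)%:A : L k) *: u.
Proof.
rewrite (kmod_basis u); apply: scaleLC_eigen.
by rewrite kmod_g; exact: kmod_basis.
Qed.

Lemma mul_block2 (A B C D : 'M[k]_1) (u : 'cV[k]_2) :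
  ((@block_mx k 1 1 1 1 A B C D : 'M_2) *m u) 0 0 =
    A 0 0 * u 0 0 + B 0 0 * u 1 0 /\
  ((@block_mx k 1 1 1 1 A B C D : 'M_2) *m u) 1 0 =
    C 0 0 * u 0 0 + D 0 0 * u 1 0.
Proof.
(* The numerals of ['I_2], the indices from expanding the sum and the block indices agree only in
   value, hence these identifications. *)
have e0 : 0 = @lshift 1 1 0 by exact: val_inj.
have e1 : 1 = @rshift 1 1 0 by exact: val_inj.
have e0' : ord0 = @lshift 1 1 0 by exact: val_inj.
have e1' : lift ord0 ord0 = 1 :> 'I_2 by exact: val_inj.
split; rewrite mxE big_ord_recl big_ord1 e1'; congr (_ * _ + _ * _).
- by rewrite e0 e0'; exact: (block_mxEul A B C D 0 0).
- by rewrite e0 e1; exact: (block_mxEur A B C D 0 0).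
- by rewrite e1 e0'; exact: (block_mxEdl A B C D 0 0).
- by rewrite e1; exact: (block_mxEdr A B C D 0 0).
Qed.

Lemma Umod_gE a b (u : Umod a b) :
  (Lg k *: u : 'cV[k]_2) 0 0 = (a : k) * (u : 'cV[k]_2) 0 0 /\
  (Lg k *: u : 'cV[k]_2) 1 0 = - ((a : k) * (u : 'cV[k]_2) 1 0).
Proof.
rewrite Umod_g; have [-> ->] := mul_block2 (a : k)%:M 0 0 (- (a : k))%:M u.
by rewrite !mxE !mul0r addr0 add0r mulNr.
Qed.

Lemma Umod_yE a b (u : Umod a b) :
  (Ly k *: u : 'cV[k]_2) 0 0 = (b : k) * (u : 'cV[k]_2) 1 0 /\
  (Ly k *: u : 'cV[k]_2) 1 0 = (u : 'cV[k]_2) 0 0.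
Proof.
rewrite Umod_y; have [-> ->] := mul_block2 0 (b : k)%:M 1%:M 0 u.
by rewrite !mxE !mul0r addr0 add0r mul1r.
Qed.

Lemma cV2P (u v : 'cV[k]_2) : u 0 0 = v 0 0 -> u 1 0 = v 1 0 -> u = v.
Proof.
move=> e0 e1; apply/colP => -[[|[|//]] lti].
  by rewrite (_ : Ordinal lti = 0) //; exact: val_inj.
by rewrite (_ : Ordinal lti = 1) //; exact: val_inj.
Qed.

Lemma Umod_y2 a b (u : Umod a b) :
  Ly k *: (Ly k *: u) = ((b : k)%:A : L k) *: u.
Proof.
have [y00 y01] := Umod_yE (Ly k *: u); have [y10 y11] := Umod_yE u.
rewrite Umod_C; apply: cV2P; rewrite [RHS]mxE.
  by rewrite y00 y11.
by rewrite y01 y10.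
Qed.

Lemma Umod_y_faithful a b (u : Umod a b) : Ly k *: u = 0 -> u = 0.
Proof.
move=> /(congr1 (fun v => Ly k *: v)).
rewrite scaler0 Umod_y2 Umod_C => /eqP.
by rewrite scaler_eq0 (negPf (valP b)) => /eqP.
Qed.

Lemma kmod_one_neq0 a : ((1 : k) : kmod a) != 0.
Proof. exact: oner_neq0. Qed.

Lemma Umod_neq0 a b : exists u : Umod a b, u != 0.
Proof.
by exists (const_mx 1); apply/eqP=> /colP/(_ 0)/eqP; rewrite !mxE oner_eq0.
Qed.

Lemma kmod_iso_inj a a' : mod_iso (kmod a) (kmod a') -> a = a'.
Proof.
case=> f bf; apply: val_inj.
apply: (scaleLC_inj (iso_neq0 bf (kmod_one_neq0 a))).
by rewrite -kmod_gE -!linearZ kmod_gE.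
Qed.

(** The scalar by which [y * y] acts is an isomorphism invariant. *)
Lemma Umod_iso_inj a b c : mod_iso (Umod a b) (Umod a c) -> b = c.
Proof.
case=> f bf; have [u u0] := Umod_neq0 a b; apply: val_inj.
apply: (scaleLC_inj (iso_neq0 bf u0)).
by rewrite -Umod_y2 -!linearZ Umod_y2.
Qed.

(** The generator [y] acts by zero on the first module and injectively on the second. *)
Lemma kmod_Umod_not_iso a a' b : ~ mod_iso (kmod a) (Umod a' b).
Proof.
case=> f bf; have /eqP[] := iso_neq0 bf (kmod_one_neq0 a).
by apply: Umod_y_faithful; rewrite -linearZ kmod_yE linear0.
Qed.

(** * Recognizing a simple module from an eigenvector of [g] *)

Lemma simple_iso_kmod V a (v : V) : simple_mod V -> v != 0 ->
  Ly k *: v = 0 -> Lg k *: v = ((a : k)%:A : L k) *: v -> mod_iso V (kmod a).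
Proof.
move=> sV v0 yv gv.
pose f (u : kmod a) := ((u : k)%:A : L k) *: v.
have lin : linear f.
  apply: L_linear => [u w|c u|u|u]; rewrite /f.
  - by rewrite !scalerDl.
  - by rewrite kmod_C scalerA mulr_algl scalerA.
  - by rewrite kmod_yE scale0r scale0r scaleLCA yv scaler0.
  - by rewrite kmod_gE kmod_C scaleLCA gv scalerA mulrC mulr_algl scalerA.
pose m := GRing.isLinear.Build _ _ _ _ _ lin.
pose F : {linear kmod a -> V} := HB.pack f m.
apply: (simple_mod_iso (f := F)) => //.
  by exists ((1 : k) : kmod a); rewrite /= /f !scale1r.
by move=> w; exact: scaleLC_eq0.
Qed.

Lemma simple_iso_Umod V a b (v : V) : (2%:R : k) != 0 -> simple_mod V ->
  Ly k *: v != 0 -> Ly k *: (Ly k *: v) = ((b : k)%:A : L k) *: v ->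
  Lg k *: v = ((a : k)%:A : L k) *: v -> mod_iso V (Umod a b).
Proof.
move=> two0 sV yv0 yyv gv.
have v0 : v != 0 by apply: contra_neq yv0 => ->; rewrite scaler0.
pose C (c : k) : L k := c%:A.
(* The standard basis vectors go to [v] and [y v]. *)
pose f (u : Umod a b) :=
  C ((u : 'cV[k]_2) 0 0) *: v + C ((u : 'cV[k]_2) 1 0) *: (Ly k *: v).
have CD (c d : k) (w : V) : C (c + d) *: w = C c *: w + C d *: w.
  by rewrite /C !scalerDl.
have CM (c d : k) (w : V) : C (c * d) *: w = C c *: (C d *: w).
  by rewrite /C scalerA mulr_algl scalerA.
have CN (c : k) (w : V) : C (- c) *: w = - (C c *: w) by rewrite /C !scaleNr.
have gyv : Lg k *: (Ly k *: v) = - (C a *: (Ly k *: v)).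
  by rewrite scalerA LgyN scaleNr -scalerA gv scaleLCA.
have lin : linear f.
  apply: L_linear => [u w|c u|u|u]; rewrite /f.
  - by rewrite !mxE !CD addrACA.
  - by rewrite Umod_C !mxE !CM -scalerDr.
  - have [-> ->] := Umod_yE u.
    by rewrite scalerDr !scaleLCA yyv addrC mulrC CM.
  - have [-> ->] := Umod_gE u.
    by rewrite scalerDr !scaleLCA gv gyv scalerN CN ![(a : k) * _]mulrC !CM.
pose m := GRing.isLinear.Build _ _ _ _ _ lin.
pose F : {linear Umod a b -> V} := HB.pack f m.
apply: (simple_mod_iso (f := F)) => //.
  exists (\col_i (i == 0)%:R); rewrite /= /f !mxE /= /C.
  by rewrite !scale0r addr0 !scale1r.
move=> u fu; have fu0 : f u = 0 := fu.
have gfu0 : f (Lg k *: u) = 0.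
  by change (F (Lg k *: u) = 0); rewrite linearZ fu /= scaler0.
(* Applying [g + a] to [f u = 0] removes the [y v] term, of eigenvalue [- a], and leaves [2 a] times
   the [v] term. *)
have : C (2%:R * ((a : k) * (u : 'cV[k]_2) 0 0)) *: v = 0.
  transitivity (f (Lg k *: u) + C a *: f u).
    rewrite /f; have [-> ->] := Umod_gE u.
    rewrite scalerDr -!CM CN mulr2n mulrDl mul1r CD.
    by rewrite addrACA addNr addr0.
  by rewrite gfu0 fu0 scaler0 addr0.
move=> /(scaleLC_eq0 v0)/eqP; rewrite !mulf_eq0 (negPf two0) (negPf (valP a)).
move=> /eqP u00; move: fu0; rewrite /f u00 /C !scale0r add0r.
by move=> /(scaleLC_eq0 yv0) u10; apply: cV2P; rewrite !mxE.
Qed.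

End Classification.

(** * The classification and the exclusivity of its cases *)

Lemma simple_mod_kmod_or_Umod (k : closedFieldType) (V : lmodType (L k)) :
  (2%:R : k) != 0 -> finite_dim V -> simple_mod V ->
  (exists a : kstar k, mod_iso V (kmod a)) \/
  (exists a b : kstar k, mod_iso V (Umod a b)).
Proof.
move=> two0 fV sV; have [V0 _] := sV.
have [a [v [a0 v0 gv]]] := Lg_eigenvector fV V0.
have [yv0|yv0] := eqVneq (Ly k *: v) 0; [left|right]; exists (exist _ a a0).
  exact: (simple_iso_kmod (a := exist _ a a0) sV v0 yv0 gv).
(* A nonzero vector killed by [y] would make [y] act by zero on all of [V], against [yv0]. *)
have y_inj (w : V) : Ly k *: w = 0 -> w = 0.
  move=> yw; apply/eqP/negPn/negP => w0; case/eqP: yv0.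
  exact: simple_mod_ann sV (@Ly_normal k) w0 yw v.
have [b [w [w0 yyw]]] := eigenvector (Ly k * Ly k) fV V0.
have b0 : b != 0.
  apply: contra_neq w0 => b0; apply/y_inj/y_inj.
  by rewrite scalerA yyw b0 !scale0r.
have yyv : Ly k *: (Ly k *: v) = (b%:A : L k) *: v.
  apply/eqP; rewrite scalerA -subr_eq0 -scalerBl; apply/eqP.
  (* The scalar [b] comes from some eigenvector [w] of [y * y]; as [y * y - b] kills [w], it kills
     all of [V], in particular the eigenvector [v] of [g]. *)
  apply: (simple_mod_ann sV (@Ly2_normal k b) w0).
  by rewrite scalerBl yyw subrr.
exists (exist _ b b0); exact: (simple_iso_Umod
  (a := exist _ a a0) (b := exist _ b b0) two0 sV yv0 yyv gv).
Qed.

Theorem proposition2p1 (k : closedFieldType) (char0 : [pchar k] =i pred0) :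
  (forall V : lmodType (L k), finite_dim V -> simple_mod V ->
     ((exists! a : kstar k, mod_iso V (kmod a)) /\
      ~ (exists a b : kstar k, mod_iso V (Umod a b))) \/
     (~ (exists a : kstar k, mod_iso V (kmod a)) /\
      (exists a b : kstar k, mod_iso V (Umod a b)))) /\
  (forall a b c : kstar k, mod_iso (Umod a b) (Umod a c) <-> b = c).
Proof.
have two0 : (2%:R : k) != 0 by have /(_ 2%N) := char0; rewrite !inE => /negbT.
have excl (V : lmodType (L k)) a a' b :
    mod_iso V (kmod a) -> ~ mod_iso V (Umod a' b).
  move=> /mod_iso_sym iVa iVb.
  exact: kmod_Umod_not_iso (mod_iso_trans iVa iVb).
split=> [V fV sV|a b c].
  have [[a iVa]|[a [b iVab]]] := simple_mod_kmod_or_Umod two0 fV sV.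
    left; split; last by case=> a' [b]; exact: excl iVa.
    exists a; split=> // a' iVa'.
    exact: kmod_iso_inj (mod_iso_trans (mod_iso_sym iVa) iVa').
  right; split; last by exists a, b.
  by case=> a' iVa'; exact: excl iVa' iVab.
split=> [|->]; first exact: Umod_iso_inj.
by exists idfun; exists idfun.
Qed.
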